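(* Let $n\ge 1$ and let $f:\{-1,1\}^n\to\mathbb{R}$ be a pseudo-Boolean function that is not identically zero, with Fourier expansion $f(x)=\sum_{I\in\mathcal{F}}\hat f(I)\chi_I(x)$, where $\mathcal{F}\subseteq\{I: I\subseteq[n]\}$ and all $\hat f(I)$ are nonzero reals. Let $m=|\mathcal{F}|$ and let $\rho\ge 0$ be the width of $f$. Then $$\|f\|_4\le \left(2\rho+1-\frac{2\rho}{m}\right)^{1/4}\|f\|_2 .$$
   Context: $[n]=\{1,\dots,n\}$ and $\chi_I(x)=\prod_{i\in I}x_i$ (with $\chi_\emptyset\equiv 1$). Every $f:\{-1,1\}^n\to\mathbb{R}$ can be written uniquely as $f(x)=\sum_{I\in\mathcal{F}}\hat f(I)\chi_I(x)$ with $\mathcal{F}$ a family of subsets of $[n]$ and each coefficient $\hat f(I)$ a nonzero real. For $i\in[n]$, $\rho_i$ is the number of sets $I\in\mathcal{F}$ with $i\in I$, and the width of $f$ is $\rho=\max\{\rho_i: i\in[n]\}$. Let $\mathbf{x}=(\mathbf{x}_1,\dots,\mathbf{x}_n)$ where the $\mathbf{x}_i$ are independent random variables, each uniform on $\{-1,1\}$. For $p\ge1$, $\|f\|_p=(\mathbb{E}[|f(\mathbf{x})|^p])^{1/p}$. *)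

(* Defs.v *)
From HB Require Import structures.
From mathcomp Require Import all_boot all_order all_algebra.
From mathcomp Require Import all_classical all_reals all_analysis.
Set Implicit Arguments.
Unset Strict Implicit.
Unset Printing Implicit Defensive.
Import Order.TTheory GRing.Theory Num.Theory.
Local Open Scope ring_scope.

(* The two-element subtype {-1, 1} of R; [ssval] is its inclusion in R. *)
Definition pm1 (R : realType) : finType := seq_sub [:: -1; 1 : R].

Definition cube (R : realType) (n : nat) : finType := {ffun 'I_n -> pm1 R}.

Definition chi (R : realType) (n : nat) (I : {set 'I_n}) (x : cube R n) : R :=
  \prod_(i in I) ssval (x i).

Definition fourier_expansion (R : realType) (n : nat) (f : cube R n -> R)
    (F : {set {set 'I_n}}) (fhat : {set 'I_n} -> R) : Prop :=
  (forall I, I \in F -> fhat I != 0) /\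
  (forall x, f x = \sum_(I in F) fhat I * chi I x).

Definition rho_at (n : nat) (F : {set {set 'I_n}}) (i : 'I_n) : nat :=
  #|[set I in F | i \in I]|.

(* For n = 0 the maximum is over the empty set and equals 0. *)
Definition width (n : nat) (F : {set {set 'I_n}}) : nat :=
  \max_(i < n) rho_at F i.

(* Coordinates independent and uniform on {-1, 1}: the point x has probability
   \prod_i 1/2. *)
Definition expect (R : realType) (n : nat) (g : cube R n -> R) : R :=
  \sum_(x : cube R n) (\prod_(i < n) 2^-1) * g x.

Definition norm_p (R : realType) (n : nat) (p : R) (f : cube R n -> R) : R :=
  (expect (fun x => `|f x| `^ p)) `^ p^-1.

(* Main.v *)
Require Import Defs.
From HB Require Import structures.
From mathcomp Require Import all_boot all_order all_algebra.
From mathcomp Require Import all_classical all_reals all_analysis.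
From mathcomp Require Import ring lra.
Set Implicit Arguments.
Unset Strict Implicit.
Unset Printing Implicit Defensive.
Import Order.TTheory GRing.Theory Num.Theory.
Local Open Scope ring_scope.

Local Notation set0 := finset.set0.

(** Parseval's identity applied to [f^2] writes [E f^4] as the sum over [D] of
    the squares of [g_D], the sum of [fhat P * fhat Q] over the ordered pairs of
    members of [F] whose symmetric difference is [D].  The term [D = set0] is
    [(E f^2)^2].  If [i \in D], then exactly one of [P] and [Q] contains [i] and
    it determines the other, so [g_D] has at most [2 rho] terms.  By the
    Cauchy-Schwarz inequality the terms with [D <> set0] add up to at most
    [2 rho] times the sum of [fhat P ^ 2 * fhat Q ^ 2] over [P <> Q], that is
    [(E f^2)^2] minus the sum of the [fhat P ^ 4], which is at least
    [(E f^2)^2 / m]. *)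

(** Cauchy-Schwarz against the constant 1. Both sides become double sums over [A], compared termwise
    by [u i * u j <= (u i ^+ 2 + u j ^+ 2) / 2]. *)
Lemma sqr_sum_le_card (R : realFieldType) (T : finType) (A : {pred T})
    (u : T -> R) :
  (\sum_(i in A) u i) ^+ 2 <= #|A|%:R * \sum_(i in A) u i ^+ 2.
Proof.
set Q := \sum_(i in A) u i ^+ 2.
have -> : #|A|%:R * Q =
    \sum_(i in A) \sum_(j in A) (2^-1 * u i ^+ 2 + 2^-1 * u j ^+ 2).
  under eq_bigr => i _ do
    rewrite big_split /= sumr_const -mulr_sumr -/Q -[_ *+ #|A|]mulr_natl.
  rewrite big_split /= sumr_const -[_ *+ #|A|]mulr_natl -mulr_sumr -mulr_sumr -/Q.
  by field.
rewrite expr2 mulr_suml ler_sum // => i _; rewrite mulr_sumr ler_sum // => j _.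
by have := sqr_ge0 (u i - u j); nra.
Qed.

Lemma sum_pm1 (R : realType) (h : R -> R) :
  \sum_(b : pm1 R) h (ssval b) = h (-1) + h 1.
Proof.
have us : uniq [:: -1; 1 : R] by rewrite /= inE andbT lt_eqF //; lra.
rewrite -(big_map (@ssval R _) xpredT h).
rewrite (perm_big [:: -1; 1 : R]) /=; first by rewrite !big_cons big_nil addr0.
apply: uniq_perm => //.
  by rewrite map_inj_uniq ?index_enum_uniq //; exact: val_inj.
move=> y; apply/mapP/idP => [[b _ ->]|ys]; first exact: ssvalP.
by exists (SeqSub ys); rewrite ?mem_index_enum.
Qed.

Lemma pm1_sqr (R : realType) (b : pm1 R) : ssval b * ssval b = 1.
Proof.
by have := ssvalP b; rewrite !inE => /orP[] /eqP ->; rewrite ?mulrNN mulr1.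
Qed.

(** The exclusive-or form reduces the group laws below to those of boolean addition. *)
Definition symdiff (T : finType) (A B : {set T}) : {set T} :=
  [set i | (i \in A) (+) (i \in B)].

Lemma symdiffA (T : finType) : associative (@symdiff T).
Proof. by move=> A B C; apply/setP => i; rewrite !inE addbA. Qed.

Lemma symdiff0s (T : finType) : left_id set0 (@symdiff T).
Proof. by move=> A; apply/setP => i; rewrite !inE addFb. Qed.

Lemma symdiffss (T : finType) (A : {set T}) : symdiff A A = set0.
Proof. by apply/setP => i; rewrite !inE addbb. Qed.

Lemma symdiffs0 (T : finType) (A : {set T}) : symdiff A set0 = A.
Proof. by apply/setP => i; rewrite !inE addbF. Qed.

Lemma symdiffK (T : finType) (A B : {set T}) : symdiff A (symdiff A B) = B.
Proof. by rewrite symdiffA symdiffss symdiff0s. Qed.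

Lemma symdiffKr (T : finType) (A B : {set T}) : symdiff (symdiff A B) B = A.
Proof. by rewrite -symdiffA symdiffss symdiffs0. Qed.

Lemma symdiff_eq0 (T : finType) (A B : {set T}) :
  (symdiff A B == set0) = (A == B).
Proof.
apply/eqP/eqP => [AB0|->]; last exact: symdiffss.
by rewrite -[A](symdiffKr A B) AB0 symdiff0s.
Qed.

Section Cube.
Variables (R : realType) (n : nat).
Implicit Types (I J K : {set 'I_n}) (g : cube R n -> R) (c : {set 'I_n} -> R).

Lemma chiM I J (x : cube R n) : chi I x * chi J x = chi (symdiff I J) x.
Proof.
rewrite /chi ![\prod_(_ in _) _]big_mkcond -big_split /=.
apply: eq_bigr => i _; rewrite inE.
by case: (i \in I); case: (i \in J); rewrite ?pm1_sqr ?mul1r ?mulr1.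
Qed.

Lemma eq_expect (g1 g2 : cube R n -> R) :
  g1 =1 g2 -> expect g1 = expect g2.
Proof. by move=> eg; apply: eq_bigr => x _; rewrite eg. Qed.

Lemma expect_ge0 g : (forall x, 0 <= g x) -> 0 <= expect g.
Proof.
move=> g0; apply: sumr_ge0 => x _; rewrite mulr_ge0 //.
by apply: prodr_ge0 => i _; rewrite invr_ge0.
Qed.

Lemma expectZ a g : expect (fun x => a * g x) = a * expect g.
Proof. by rewrite /expect mulr_sumr; apply: eq_bigr => x _; rewrite mulrCA. Qed.

Lemma expect_sum (T : finType) (P : pred T) (G : T -> cube R n -> R) :
  expect (fun x => \sum_(t | P t) G t x) = \sum_(t | P t) expect (G t).
Proof.
by rewrite /expect exchange_big; apply: eq_bigr => x _; rewrite mulr_sumr.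
Qed.

(** By independence the mean factors over the coordinates, and each coordinate in [K] contributes
    the factor [(-1 + 1) / 2 = 0]. *)
Lemma expect_chi K : expect (chi K : cube R n -> R) = (K == set0)%:R.
Proof.
have -> : expect (chi K : cube R n -> R) =
    \sum_(x : {ffun 'I_n -> pm1 R}) \prod_i
       (2^-1 * (if i \in K then ssval (x i) else 1)).
  by apply: eq_bigr => x _; rewrite /chi [\prod_(_ in _) _]big_mkcond -big_split.
rewrite -(bigA_distr_bigA
  (fun i (b : pm1 R) => 2^-1 * (if i \in K then ssval b else 1))).
under eq_bigr => i _ do
  rewrite (sum_pm1 (fun b => 2^-1 * (if i \in K then b else 1))).
case: (set_0Vmem K) => [->|[i iK]].
  by rewrite eqxx big1 // => i _; rewrite inE; field.
rewrite (bigD1 i) //= iK (_ : _ + _ = 0); last by ring.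
by rewrite mul0r; case: eqP iK => // ->; rewrite inE.
Qed.

(** The characters are orthonormal: [chi I * chi J] is again a character, with mean zero unless
    [I = J]. *)
Lemma parseval c :
  expect (fun x : cube R n => (\sum_I c I * chi I x) ^+ 2) = \sum_I c I ^+ 2.
Proof.
have E x : (\sum_I c I * chi I x) ^+ 2 =
    \sum_I \sum_J (c I * c J) * chi (symdiff I J) x :> R.
  rewrite expr2 mulr_suml; apply: eq_bigr => I _.
  by rewrite mulr_sumr; apply: eq_bigr => J _; rewrite mulrACA chiM.
rewrite (eq_expect E) expect_sum; apply: eq_bigr => I _.
rewrite expect_sum (bigD1 I) //= big1 => [|J JI].
  by rewrite expectZ expect_chi symdiffss eqxx mulr1 addr0 expr2.
by rewrite expectZ expect_chi symdiff_eq0 eq_sym (negbTE JI) mulr0.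
Qed.

End Cube.

Section Width.
Variables (n : nat) (F : {set {set 'I_n}}).

Definition symdiff_pairs (D : {set 'I_n}) : {set {set 'I_n} * {set 'I_n}} :=
  [set pq in finset.setX F F | symdiff pq.1 pq.2 == D].

Lemma card_symdiff_pairs_le D :
  D != set0 -> (#|symdiff_pairs D| <= 2 * width F)%N.
Proof.
case/set0Pn => i iD; set Fi := [set I in F | i \in I].
have leFi : (#|Fi| <= width F)%N by exact: (leq_bigmax (F := rho_at F) i).
(* The first image covers the pairs with [i] in [P], the second those with [i] in [Q]. *)
have sub : symdiff_pairs D \subset
    [set (P, symdiff P D) | P in Fi] :|: [set (symdiff Q D, Q) | Q in Fi].
  apply/fintype.subsetP => -[P Q]; rewrite !inE /= => /andP[/andP[PF QF] /eqP eD].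
  move: iD; rewrite -eD inE; case iP: (i \in P); case iQ: (i \in Q) => // _.
    apply/orP; left; apply/imsetP; exists P; first by rewrite inE PF iP.
    by rewrite symdiffK.
  apply/orP; right; apply/imsetP; exists Q; first by rewrite inE QF iQ.
  by congr pair; apply/setP => j; rewrite !inE addbC addbK.
apply: leq_trans (subset_leq_card sub) _.
rewrite mul2n -addnn; apply: leq_trans (leq_card_setU _ _) _.
by apply: leq_add; apply: leq_trans (leq_imset_card _ _) leFi.
Qed.

End Width.

Section FourthMoment.
Variables (R : realType) (n : nat) (f : cube R n -> R).
Variables (F : {set {set 'I_n}}) (fhat : {set 'I_n} -> R).
Hypothesis fE : forall x, f x = \sum_(I in F) fhat I * chi I x.

(** The Fourier coefficient of the square of [f] at [D]. *)
Let g D := \sum_(pq in symdiff_pairs F D) fhat pq.1 * fhat pq.2.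

Lemma expect_sqr : expect (fun x => f x ^+ 2) = \sum_(I in F) fhat I ^+ 2.
Proof.
(* The coefficients are extended by zero, since [parseval] sums over all sets. *)
have E x : f x ^+ 2 = (\sum_I (if I \in F then fhat I else 0) * chi I x) ^+ 2.
  rewrite fE big_mkcond; congr (_ ^+ 2).
  by apply: eq_bigr => I _; case: ifP; rewrite ?mul0r.
rewrite (eq_expect E) parseval [RHS]big_mkcond; apply: eq_bigr => I _.
by case: ifP => // _; rewrite expr0n.
Qed.

(** The sets [symdiff_pairs F D] are the fibres of the symmetric difference on [F] times [F]. *)
Lemma sum_symdiff_pairs (h : {set 'I_n} * {set 'I_n} -> R) (P : pred {set 'I_n}) :
  \sum_(D | P D) \sum_(pq in symdiff_pairs F D) h pq =
  \sum_(pq in finset.setX F F | P (symdiff pq.1 pq.2)) h pq.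
Proof.
rewrite [RHS](partition_big (fun pq => symdiff pq.1 pq.2) P) /=; last first.
  by move=> pq /andP[].
apply: eq_bigr => D PD; apply: eq_bigl => pq; rewrite inE.
by case: eqP => [->|]; rewrite ?PD ?andbT ?andbF.
Qed.

Lemma expect_pow4 : expect (fun x => f x ^+ 4) = \sum_D g D ^+ 2.
Proof.
rewrite -(parseval (R := R)); apply: eq_expect => x.
rewrite (exprM (f x) 2 2); congr (_ ^+ 2).
under [RHS]eq_bigr => D _ do rewrite mulr_suml.
have E D : \sum_(pq in symdiff_pairs F D) fhat pq.1 * fhat pq.2 * chi D x =
   \sum_(pq in symdiff_pairs F D) (fhat pq.1 * chi pq.1 x) * (fhat pq.2 * chi pq.2 x).
  apply: eq_bigr => pq; rewrite inE => /andP[_ /eqP <-].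
  by rewrite mulrACA chiM.
under eq_bigr => D _ do rewrite E.
rewrite (sum_symdiff_pairs _ xpredT) expr2 fE mulr_suml.
under eq_bigr => I _ do rewrite mulr_sumr.
by rewrite pair_big /=; apply: eq_bigl => -[P Q]; rewrite inE andbT.
Qed.

Lemma expect_pow4_le :
  expect (fun x => f x ^+ 4) <=
  (2 * (width F)%:R + 1 - 2 * (width F)%:R / #|F|%:R) *
  expect (fun x => f x ^+ 2) ^+ 2.
Proof.
rewrite expect_pow4 expect_sqr; set r := (width F)%:R.
set S := \sum_(I in F) fhat I ^+ 2; set Q := \sum_(I in F) (fhat I ^+ 2) ^+ 2.
have r0 : 0 <= r :> R by rewrite ler0n.
(* Cauchy-Schwarz for the squared coefficients. For empty [F] the inverse of 0 is 0, so the left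
   side vanishes. *)
have SQ : S ^+ 2 / #|F|%:R <= Q.
  have [F0|F0] := posnP #|F|.
    by rewrite F0 invr0 mulr0 sumr_ge0 // => I _; exact: sqr_ge0.
  by rewrite ler_pdivrMr ?ltr0n // mulrC sqr_sum_le_card.
have diag (h : {set 'I_n} * {set 'I_n} -> R) :
    \sum_(pq in finset.setX F F | symdiff pq.1 pq.2 == set0) h pq =
    \sum_(I in F) h (I, I).
  transitivity (\sum_(P in F) \sum_(P' | P' == P) h (P, P')); last first.
    by apply: eq_bigr => I _; rewrite big_pred1_eq.
  rewrite pair_big_dep; apply: eq_big => [[P P'] /=|[]//].
  rewrite inE /= symdiff_eq0 [P' == P]eq_sym.
  by case: eqP => [->|]; rewrite ?andbb ?andbT ?andbF.
have g0 : g set0 = S.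
  rewrite -[LHS](big_pred1_eq +%R set0 g) sum_symdiff_pairs diag.
  by apply: eq_bigr => I _; rewrite expr2.
have all : \sum_(pq in finset.setX F F) (fhat pq.1 * fhat pq.2) ^+ 2 = S ^+ 2.
  rewrite expr2 [RHS]mulr_suml.
  under [RHS]eq_bigr => I _ do rewrite mulr_sumr.
  rewrite pair_big /=; apply: eq_big => -[P P'] /=; rewrite ?inE // => _.
  by rewrite exprMn.
have off : \sum_(D | D != set0) g D ^+ 2 <= 2 * r * (S ^+ 2 - Q).
  (* Of all the pairs, whose total is [S ^+ 2], the diagonal ones contribute [Q]. *)
  have -> : S ^+ 2 - Q = \sum_(D | D != set0)
      \sum_(pq in symdiff_pairs F D) (fhat pq.1 * fhat pq.2) ^+ 2.
    rewrite sum_symdiff_pairs -all.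
    rewrite (bigID (fun pq => symdiff pq.1 pq.2 == set0)) /= diag /=.
    under eq_bigr => I _ do rewrite -expr2.
    by rewrite addrC addrK.
  rewrite mulr_sumr; apply: ler_sum => D D0.
  apply: le_trans (sqr_sum_le_card _ _) _.
  apply: ler_wpM2r; first by apply: sumr_ge0 => ? _; exact: sqr_ge0.
  by rewrite -natrM ler_nat card_symdiff_pairs_le.
rewrite (bigD1 set0) //= g0.
(* With [SQ] multiplied by [r], the goal is linear in the remaining monomials. *)
have := ler_wpM2l r0 SQ; move: off; set k := #|F|%:R^-1; nra.
Qed.

End FourthMoment.

Theorem theorem1 (R : realType) (n : nat) (hn : (1 <= n)%N)
    (f : cube R n -> R) (hf : exists x, f x != 0)
    (F : {set {set 'I_n}}) (fhat : {set 'I_n} -> R)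
    (hexp : fourier_expansion f F fhat)
    (m : nat) (hm : m = #|F|) (rho : nat) (hrho : rho = width F) :
  norm_p 4 f <= (2 * rho%:R + 1 - 2 * rho%:R / m%:R) `^ (1 / 4) * norm_p 2 f.
Proof.
case: hexp => _ fE.
have normE (k : nat) : ~~ odd k -> norm_p k%:R f =
    expect (fun x => f x ^+ k) `^ k%:R^-1.
  move=> ek; congr (_ `^ _); apply: eq_expect => x.
  by rewrite powR_mulrn // -normrX ger0_norm // real_exprn_even_ge0 ?num_real.
rewrite (normE 4) // (normE 2) //.
have E2 : 0 <= expect (fun x => f x ^+ 2).
  by apply: expect_ge0 => x; exact: sqr_ge0.
(* The square root is rewritten as a fourth root, so that both sides are fourth roots and
   monotonicity reduces the claim to the moments. *)
have -> : expect (fun x => f x ^+ 2) `^ 2%:R^-1 =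
    (expect (fun x => f x ^+ 2) ^+ 2) `^ (1 / 4).
  by rewrite -powR_mulrn // -powRrM; congr (_ `^ _); field.
(* The factor is [1 + 2 * rho * (1 - 1 / m)]; its sign is needed to merge the two fourth roots. *)
have C0 : 0 <= 2 * rho%:R + 1 - 2 * rho%:R / m%:R :> R.
  have r0 : 0 <= rho%:R :> R by rewrite ler0n.
  have : m%:R^-1 <= 1 :> R.
    by case: (m) => [|k]; rewrite ?invr0 // invf_le1 ?ltr0n // ler1n.
  by move: (m%:R^-1) => k; nra.
rewrite -powRM ?sqr_ge0 // div1r; apply: ge0_ler_powR; rewrite ?invr_ge0 //.
- by rewrite nnegrE expect_ge0 // => x; rewrite real_exprn_even_ge0 ?num_real.
- by rewrite nnegrE mulr_ge0 ?sqr_ge0.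
- by rewrite hrho hm; exact: expect_pow4_le fE.
Qed.
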